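(* Let $\boldsymbol{x}=\{x_1,\dots,x_n\}$ and $\boldsymbol{X}=\{X_1,\dots,X_n\}$. The Magnus maps $$\mathcal M\colon \mathcal F(\boldsymbol{x})\to\overline{\mathbb{Q}\{\boldsymbol{X}\}}^{\times},\quad x_i\mapsto 1+X_i,$$ and $$\mathcal M_c\colon \mathcal F_c(\boldsymbol{x})\to\overline{\mathbb{Q}_c\{\boldsymbol{X}\}}^{\times},\quad x_i\mapsto 1+X_i,$$ are injective.
   Context: $\mathcal F(\boldsymbol{x})$ denotes the free loop on $\boldsymbol{x}$ and $\mathcal F_c(\boldsymbol{x})$ the free commutative loop on $\boldsymbol{x}$ (a loop being a set with a product and two-sided identity in which all left and right multiplications are bijective). $\mathbb{Q}\{\boldsymbol{X}\}$ is the free non-associative (non-commutative) algebra over $\mathbb{Q}$ on $\boldsymbol{X}$, and $\mathbb{Q}_c\{\boldsymbol{X}\}$ the free commutative non-associative algebra over $\mathbb{Q}$ on $\boldsymbol{X}$; the overline denotes completion with respect to degree, i.e. the algebra of non-associative formal power series. The elements of such a completion with non-zero constant term form a loop under multiplication, denoted by the superscript $\times$. $\mathcal M$ and $\mathcal M_c$ are the unique loop homomorphisms determined by the given values on generators. *)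

(* Defs.v *)
From mathcomp Require Import all_boot all_algebra.
Set Implicit Arguments. Unset Strict Implicit. Unset Printing Implicit Defensive.
Import GRing.Theory.
Local Open Scope ring_scope.

Inductive lterm (n : nat) : Type :=
| LGen of 'I_n
| LOne
| LMul of lterm n & lterm n
| LLdiv of lterm n & lterm n   (* x \ y : the unique z with x * z = y *)
| LRdiv of lterm n & lterm n.  (* y / x : the unique z with z * x = y *)
Arguments LOne {n}.

(* [loop_eq comm] is the least congruence containing the loop axioms,
   plus commutativity when [comm = true].  The free loop F(x) is
   [lterm n] modulo [loop_eq false]; the free commutative loop F_c(x)
   is [lterm n] modulo [loop_eq true]. *)
Inductive loop_eq (comm : bool) (n : nat) : lterm n -> lterm n -> Prop :=
| le_refl x : loop_eq comm x x
| le_sym x y : loop_eq comm x y -> loop_eq comm y x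
| le_trans x y z : loop_eq comm x y -> loop_eq comm y z -> loop_eq comm x z
| le_mul x x' y y' : loop_eq comm x x' -> loop_eq comm y y' ->
    loop_eq comm (LMul x y) (LMul x' y')
| le_ldiv x x' y y' : loop_eq comm x x' -> loop_eq comm y y' ->
    loop_eq comm (LLdiv x y) (LLdiv x' y')
| le_rdiv x x' y y' : loop_eq comm x x' -> loop_eq comm y y' ->
    loop_eq comm (LRdiv x y) (LRdiv x' y')
| le_mul1l x : loop_eq comm (LMul LOne x) x
| le_mul1r x : loop_eq comm (LMul x LOne) x
| le_ldiv_mul x y : loop_eq comm (LLdiv x (LMul x y)) y
| le_mul_ldiv x y : loop_eq comm (LMul x (LLdiv x y)) y
| le_rdiv_mul x y : loop_eq comm (LRdiv (LMul y x) x) y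
| le_mul_rdiv x y : loop_eq comm (LMul (LRdiv y x) x) y
| le_comm x y : comm = true -> loop_eq comm (LMul x y) (LMul y x).

(* Non-empty non-associative monomials: planar binary trees with leaves
   labelled by the variables.  A monomial is [None] (the empty monomial 1)
   or [Some t]. *)
Inductive tree (n : nat) : Type :=
| Leaf of 'I_n
| Node of tree n & tree n.

(* Equality of commutative non-associative monomials: trees up to
   swapping the two children at any node. *)
Fixpoint teq (n : nat) (s t : tree n) : bool :=
  match s, t with
  | Leaf i, Leaf j => i == j
  | Node a b, Node c d => (teq a c && teq b d) || (teq a d && teq b c)
  | _, _ => false
  end.

(* A formal series = its coefficient function on monomials.
   In the non-commutative case this is exactly an element of the
   completion of Q{X}.  In the commutative case an element of the
   completion of Q_c{X} is represented by the function assigning to every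
   tree the coefficient of its [teq]-class (such functions are
   [teq]-invariant, and all series used below are of this form). *)
Definition series (n : nat) := option (tree n) -> rat.

(* The "cross" term of the coefficient of the monomial (u v) in f * g:
   non-commutative case: f_u g_v;
   commutative case: sum over ordered pairs of classes (c1,c2) with
   [c1 c2] = [u v], i.e. f_u g_v + f_v g_u if u, v are inequivalent,
   f_u g_v otherwise. *)
Definition cross (comm : bool) (n : nat) (f g : series n) (u v : tree n) : rat :=
  f (Some u) * g (Some v)
  + (if comm && ~~ teq u v then f (Some v) * g (Some u) else 0).

Definition smul (comm : bool) (n : nat) (f g : series n) : series n :=
  fun m => match m with
  | None => f None * g None
  | Some t =>
      f None * g (Some t) + f (Some t) * g None +
      match t with Leaf _ => 0 | Node u v => cross comm f g u v end
  end.

(* Left division a \ b: the unique c with a * c = b (a has non-zero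
   constant term); coefficients solved by recursion on the monomial. *)
Definition sldiv (comm : bool) (n : nat) (a b : series n) : tree n -> rat :=
  let c0 := b None / a None in
  fix cf (t : tree n) : rat :=
    match t with
    | Leaf i => (b (Some t) - a (Some t) * c0) / a None
    | Node u v =>
        (b (Some t) - a (Some t) * c0
         - (a (Some u) * cf v
            + (if comm && ~~ teq u v then a (Some v) * cf u else 0)))
        / a None
    end.

Definition sldivS (comm : bool) (n : nat) (a b : series n) : series n :=
  fun m => match m with
  | None => b None / a None
  | Some t => sldiv comm a b t
  end.

(* Right division b / a: the unique c with c * a = b. *)
Definition srdiv (comm : bool) (n : nat) (b a : series n) : tree n -> rat :=
  let c0 := b None / a None in
  fix cf (t : tree n) : rat :=
    match t with
    | Leaf i => (b (Some t) - c0 * a (Some t)) / a None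
    | Node u v =>
        (b (Some t) - c0 * a (Some t)
         - (cf u * a (Some v)
            + (if comm && ~~ teq u v then cf v * a (Some u) else 0)))
        / a None
    end.

Definition srdivS (comm : bool) (n : nat) (b a : series n) : series n :=
  fun m => match m with
  | None => b None / a None
  | Some t => srdiv comm b a t
  end.

Definition sone (n : nat) : series n :=
  fun m => match m with None => 1 | Some _ => 0 end.

Definition sgen (n : nat) (i : 'I_n) : series n :=
  fun m => match m with
  | None => 1
  | Some (Leaf j) => if j == i then 1 else 0
  | Some (Node _ _) => 0
  end.

(* The Magnus map: the loop homomorphism x_i |-> 1 + X_i, computed on
   representative terms.  [magnus false] is M, [magnus true] is M_c. *)
Fixpoint magnus (comm : bool) (n : nat) (t : lterm n) : series n :=
  match t with
  | LGen i => sgen i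
  | LOne => @sone n
  | LMul x y => smul comm (magnus comm x) (magnus comm y)
  | LLdiv x y => sldivS comm (magnus comm x) (magnus comm y)
  | LRdiv y x => srdivS comm (magnus comm y) (magnus comm x)
  end.

(* Main.v *)
(* The coefficients of the Magnus series are functions c_u on the free loop with
   c_(uv)(xy) = c_(uv)(x) + c_(uv)(y) + c_u(x) c_v(y) (symmetrized in the
   commutative case).  By induction on trees, every product c_u c_v has a
   coboundary of this bilinear kind, so the span of the c_u is closed under
   products; hence it interpolates arbitrary values, 0 at the identity, on
   finitely many elements with distinct Magnus series.  For the same reason a
   delta cocycle concentrated on a single pair (a, b) agrees, on any finite set
   of pairs, with the coboundary of a function f in the span that vanishes on
   the generators.  Let S be a finite set of terms, closed under operands, on
   which the Magnus map is injective, and suppose that a, b, c in S satisfy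
   M(ab) = M(c) while ab and c differ in the free loop.  Then no product inside
   S is taken at (a, b), so f vanishes on S, but f(ab) - f(a) - f(b) <> 0 and
   f(ab) = f(c): a contradiction.  This lets S grow one operation at a time
   without losing injectivity. *)
Require Import Defs.
From HB Require Import structures.
From mathcomp Require Import all_boot all_algebra.
From mathcomp Require Import ring.
From Stdlib Require Import Classical.
Set Implicit Arguments. Unset Strict Implicit. Unset Printing Implicit Defensive.
Import GRing.Theory.
Local Open Scope ring_scope.

Lemma lterm_comparable n : comparable (lterm n).
Proof. rewrite /comparable /decidable; decide equality; exact: eq_comparable. Qed.

HB.instance Definition _ n := comparableMixin (@lterm_comparable n).

(** * Equivalence of commutative monomials *)

Lemma teq_refl n (t : tree n) : teq t t.
Proof. by elim: t => [i|a IHa b IHb] /=; rewrite ?IHa ?IHb ?eqxx. Qed.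

Lemma teq_sym n (s t : tree n) : teq s t = teq t s.
Proof.
elim: s t => [i|a IHa b IHb] [j|c d] //=.
by rewrite (IHa c) (IHa d) (IHb c) (IHb d) [X in _ || X]andbC.
Qed.

Lemma teq_trans n (t s u : tree n) : teq s t -> teq t u -> teq s u.
Proof.
elim: t s u => [i|a IHa b IHb] [j|c d] [k|e f] //=; first by move=> /eqP-> /eqP->.
by case/orP=> /andP[h1 h2] /orP[] /andP[h3 h4]; apply/orP;
  [left|right|right|left]; apply/andP; split;
  first [exact: IHa h1 _ | exact: IHa h2 _ | exact: IHb h1 _ | exact: IHb h2 _].
Qed.

Definition teq_invariant n (f : tree n -> rat) := forall s t, teq s t -> f s = f t.

(** The sum runs over ordered pairs of classes whose product is the class of the node. Invariance of
    [g] is asked only at [u] and [v]: for quotients the induction supplies no more. *)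
Lemma cross_teq n (f g : tree n -> rat) (u v u' v' : tree n) :
  teq_invariant f -> (forall w, teq u w -> g u = g w) ->
  (forall w, teq v w -> g v = g w) -> teq (Node u v) (Node u' v') ->
  f u * g v + (if ~~ teq u v then f v * g u else 0) =
  f u' * g v' + (if ~~ teq u' v' then f v' * g u' else 0).
Proof.
move=> fP gu gv /= /orP[] /andP[hu hv].
  have -> : teq u' v' = teq u v.
    apply/idP/idP => h.
      by apply: teq_trans hu _; apply: teq_trans h _; rewrite teq_sym.
    by apply: teq_trans hv; apply: teq_trans h; rewrite teq_sym.
  by rewrite (fP _ _ hu) (fP _ _ hv) (gu _ hu) (gv _ hv).
have -> : teq u' v' = teq u v.
  rewrite [RHS]teq_sym; apply/idP/idP => h.
    by apply: teq_trans hv _; apply: teq_trans h _; rewrite teq_sym.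
  by apply: teq_trans hu; apply: teq_trans h; rewrite teq_sym.
rewrite (fP _ _ hu) (fP _ _ hv) -(gu _ hu) -(gv _ hv).
case: ifP => [_|/negbFE h]; first exact: addrC.
by rewrite (gu _ h) -(fP _ _ hu) -(fP _ _ hv) (fP _ _ h).
Qed.

Lemma magnus_teq n (t : lterm n) : teq_invariant (fun u => magnus true t (Some u)).
Proof.
elim: t => [i||x IHx y IHy|x IHx y IHy|y IHy x IHx] u;
  elim: u => [j|u IHu v IHv] [k|u' v'] //.
- by move/eqP->.
- by move/eqP->.
- move=> h; rewrite /= (IHx _ _ h) (IHy _ _ h) /cross; congr (_ + _).
  exact: (cross_teq IHx (IHy u) (IHy v) h).
- by move/eqP->.
- move=> h; rewrite /= (IHx _ _ h) (IHy _ _ h); congr ((_ - _) / _).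
  exact: (cross_teq IHx IHu IHv h).
- by move/eqP->.
- move=> h; rewrite /= (IHx _ _ h) (IHy _ _ h); congr ((_ - _) / _).
  (* The quotient is the left factor here; commuting factors and swapping children gives the shape
     of [cross_teq]. *)
  rewrite ![srdiv _ _ _ _ * _]mulrC (teq_sym u) (teq_sym u').
  by apply: (cross_teq IHx IHv IHu); rewrite /= andbC [X in _ || X]andbC.
Qed.

(** * Equality of Magnus series *)

Section Magnus.
Variables (comm : bool) (n : nat).
Implicit Types (s t x y : lterm n) (f g h : lterm n -> rat) (u v : tree n).

Local Notation M := (@magnus comm n).

Lemma magnus_None t : M t None = 1.
Proof. by elim: t => [i||x IHx y IHy|x IHx y IHy|x IHx y IHy] //=; rewrite IHx IHy ?mulr1 ?divr1. Qed.

Definition meq s t := forall m, M s m = M t m.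

Lemma meq_sym s t : meq s t -> meq t s.
Proof. by move=> h m. Qed.

Lemma meq_trans t s x : meq s t -> meq t x -> meq s x.
Proof. by move=> h1 h2 m; rewrite h1. Qed.

Lemma meq_mul s s' t t' : meq s s' -> meq t t' -> meq (LMul s t) (LMul s' t').
Proof. by move=> hs ht [[i|u v]|] /=; rewrite /cross ?hs ?ht. Qed.

Lemma meq_mul_ldiv x y : meq (LMul x (LLdiv x y)) y.
Proof.
by move=> [[i|u v]|]; rewrite /= /cross /= ?magnus_None; [field|field|rewrite mul1r divr1].
Qed.

Lemma meq_mul_rdiv x y : meq (LMul (LRdiv y x) x) y.
Proof.
by move=> [[i|u v]|]; rewrite /= /cross /= ?magnus_None; [field|field|rewrite mulr1 divr1].
Qed.

Lemma meq_mulC x y : comm -> meq (LMul x y) (LMul y x).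
Proof.
rewrite /meq; case: comm => // _ [[i|u v]|] /=; [by ring| |exact: mulrC].
rewrite /cross /=; case: ifP => [_|/negbFE h]; first by ring.
by rewrite !(magnus_teq _ h); ring.
Qed.

(** * Span of the coefficient functions and coboundaries *)

Inductive coef_span : (lterm n -> rat) -> Prop :=
| span_coef u : coef_span (fun t => M t (Some u))
| span0 : coef_span (fun=> 0)
| span_lin a f g : coef_span f -> coef_span g -> coef_span (fun t => a * f t + g t)
| span_ext f g : coef_span f -> f =1 g -> coef_span g.

Lemma span_meq f s t : coef_span f -> meq s t -> f s = f t.
Proof.
move=> fP h; elim: fP => [u||a g1 g2 _ IH1 _ IH2|g1 g2 _ IH e] //.
  by rewrite IH1 IH2.
by rewrite -!e.
Qed.

Lemma span_one f : coef_span f -> f LOne = 0.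
Proof.
elim=> [u||a g1 g2 _ IH1 _ IH2|g1 g2 _ IH e] //; first by rewrite IH1 IH2; ring.
by rewrite -e.
Qed.

(** Symmetrized when [comm] holds, since coboundaries on a commutative loop are symmetric. *)
Definition symt f g x y : rat := f x * g y + (if comm then g x * f y else 0).

Definition cobounds (b : lterm n -> lterm n -> rat) :=
  exists f, [/\ coef_span f, forall i, f (LGen i) = 0 &
    forall x y, f (LMul x y) = f x + f y + b x y].

Lemma cobounds_lin a b1 b2 : cobounds b1 -> cobounds b2 ->
  cobounds (fun x y => a * b1 x y + b2 x y).
Proof.
move=> [f1 [s1 g1 h1]] [f2 [s2 g2 h2]]; exists (fun t => a * f1 t + f2 t); split.
- exact: span_lin.
- by move=> i; rewrite g1 g2; ring.
- by move=> x y; rewrite h1 h2; ring.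
Qed.

Lemma cobounds_ext b1 b2 : cobounds b1 -> b1 =2 b2 -> cobounds b2.
Proof. by move=> [f [s g h]] e; exists f; split=> // x y; rewrite h e. Qed.

(* The factor 1/2 compensates for [symt] counting the single ordered pair of
   equivalent classes twice. *)
Definition kappa u v : rat := if comm && teq u v then 2^-1 else 1.

Lemma magnus_leaf_mul i x y :
  M (LMul x y) (Some (Leaf i)) = M x (Some (Leaf i)) + M y (Some (Leaf i)).
Proof. by rewrite /= !magnus_None; ring. Qed.

Lemma magnus_node_mul u v x y : M (LMul x y) (Some (Node u v)) =
  M x (Some (Node u v)) + M y (Some (Node u v)) +
  kappa u v * symt (fun t => M t (Some u)) (fun t => M t (Some v)) x y.
Proof.
rewrite /= !magnus_None /cross /kappa /symt.
case: comm => /=; last by ring.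
by case h: (teq u v) => /=; [rewrite !(magnus_teq _ h); field|ring].
Qed.

(** By bilinearity only pairs c_u, c_v matter, and c_(uv) divided by [kappa u v] serves them; it
    vanishes on generators, having degree at least two. *)
Lemma cobounds_symt f g : coef_span f -> coef_span g -> cobounds (symt f g).
Proof.
move=> fP; elim: fP g => [u||a f1 f2 _ IH1 _ IH2|f1 f2 _ IH e] g gP; last first.
- by apply: cobounds_ext (IH _ gP) _ => x y; rewrite /symt !e.
- apply: cobounds_ext (cobounds_lin a (IH1 _ gP) (IH2 _ gP)) _ => x y.
  by rewrite /symt; case: comm; ring.
- exists (fun=> 0); split=> // [|x y]; first exact: span0.
  by rewrite /symt; case: comm; ring.
elim: gP => [v||a g1 g2 _ IH1 _ IH2|g1 g2 _ IH e]; last first.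
- by apply: cobounds_ext IH _ => x y; rewrite /symt !e.
- apply: cobounds_ext (cobounds_lin a IH1 IH2) _ => x y.
  by rewrite /symt; case: comm; ring.
- exists (fun=> 0); split=> // [|x y]; first exact: span0.
  by rewrite /symt; case: comm; ring.
have k0 : kappa u v != 0 by rewrite /kappa; case: ifP.
pose c u t := M t (Some u).
exists (fun t => (kappa u v)^-1 * c (Node u v) t + 0); split.
- exact: span_lin (span_coef _) span0.
- by move=> i; rewrite /c /= !mulr0 addr0.
- by move=> x y; rewrite /c magnus_node_mul; field.
Qed.

(** * Recovery from coboundaries, products, interpolation *)

Lemma additive_eq0 f : (forall s t, meq s t -> f s = f t) ->
  (forall s t, f (LMul s t) = f s + f t) -> (forall i, f (LGen i) = 0) ->
  forall t, f t = 0.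
Proof.
move=> fr fM fG; elim=> [i||x IHx y IHy|x IHx y IHy|y IHy x IHx] //.
(* The relation 1 1 = 1 forces 0 at the identity; x (x \ y) = y and (y / x) x = y force 0 at
   quotients. *)
- have := fM LOne LOne.
  have /fr -> : meq (LMul LOne LOne) LOne by move=> [[i|u v]|] /=; rewrite /cross /= ?if_same; ring.
  by move/eqP; rewrite -subr_eq0 opprD addNKr oppr_eq0 => /eqP.
- by rewrite fM IHx IHy addr0.
- by have := fM x (LLdiv x y); rewrite (fr _ _ (meq_mul_ldiv x y)) IHx IHy add0r.
- by have := fM (LRdiv y x) x; rewrite (fr _ _ (meq_mul_rdiv x y)) IHx IHy addr0.
Qed.

Lemma span_sum (a : 'I_n -> rat) (r : seq 'I_n) :
  coef_span (fun t => \sum_(i <- r) a i * M t (Some (Leaf i))).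
Proof.
elim: r => [|i r IH]; first by apply: span_ext span0 _ => t; rewrite big_nil.
by apply: span_ext (span_lin (a i) (span_coef (Leaf i)) IH) _ => t; rewrite big_cons.
Qed.

(* Up to a linear combination of the degree-one coefficients, a function is
   determined by its coboundary. *)
Lemma span_cobounds f b : (forall s t, meq s t -> f s = f t) ->
  (forall x y, f (LMul x y) = f x + f y + b x y) -> cobounds b -> coef_span f.
Proof.
move=> fr fM [g [gP gG gM]].
have hP := span_lin 1 gP (span_sum (fun i => f (LGen i)) (index_enum 'I_n)).
apply: span_ext hP _ => t /=; apply/eqP; rewrite -subr_eq0; apply/eqP.
move: t; apply: additive_eq0 => [s t h|s t|i].
- by rewrite (fr _ _ h) (span_meq gP h) (span_meq (span_sum _ _) h).
- rewrite fM gM; under eq_bigr => i _ do rewrite magnus_leaf_mul mulrDr.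
  by rewrite big_split /=; ring.
- rewrite gG (bigD1 i) //= eqxx big1; first by ring.
  by move=> j /negbTE ->; rewrite mulr0.
Qed.

(** The coboundary of c_u c_v combines [symt] of coefficients and of products in which u or v is
    replaced by a proper subtree; hence the double induction. *)
Lemma span_coefM u v : coef_span (fun t => M t (Some u) * M t (Some v)).
Proof.
pose c u t := M t (Some u).
(* Both c_u(x) c_v(y) and c_v(x) c_u(y) occur: two values of [symt] without commutativity, one with
   it. *)
pose e : rat := if comm then 0 else 1.
have cr w1 w2 s t : meq s t -> c w1 s * c w2 s = c w1 t * c w2 t.
  by move=> h; rewrite /c !h.
have sc w : coef_span (c w) := span_coef w.
elim: u v => [i|u1 IHu1 u2 IHu2] v.
  elim: v => [j|v1 IHv1 v2 IHv2].
    apply: (span_cobounds (cr _ _)) (cobounds_lin e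
      (cobounds_symt (sc (Leaf j)) (sc (Leaf i)))
      (cobounds_symt (sc (Leaf i)) (sc (Leaf j)))) => x y.
    by rewrite /c !magnus_leaf_mul /symt /e; case: comm; ring.
  apply: (span_cobounds (cr _ _)) (cobounds_lin e
      (cobounds_symt (sc (Node v1 v2)) (sc (Leaf i)))
      (cobounds_lin (kappa v1 v2) (cobounds_symt IHv1 (sc v2))
      (cobounds_lin (kappa v1 v2) (cobounds_symt (sc v1) IHv2)
      (cobounds_symt (sc (Leaf i)) (sc (Node v1 v2)))))) => x y.
  by rewrite /c magnus_leaf_mul magnus_node_mul /symt /e; case: comm; ring.
elim: v => [j|v1 IHv1 v2 IHv2].
  apply: (span_cobounds (cr _ _)) (cobounds_lin e
      (cobounds_symt (sc (Leaf j)) (sc (Node u1 u2)))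
      (cobounds_lin (kappa u1 u2) (cobounds_symt (IHu1 (Leaf j)) (sc u2))
      (cobounds_lin (kappa u1 u2) (cobounds_symt (sc u1) (IHu2 (Leaf j)))
      (cobounds_symt (sc (Node u1 u2)) (sc (Leaf j)))))) => x y.
  by rewrite /c magnus_leaf_mul magnus_node_mul /symt /e; case: comm; ring.
apply: (span_cobounds (cr _ _)) (cobounds_lin e
      (cobounds_symt (sc (Node v1 v2)) (sc (Node u1 u2)))
      (cobounds_lin (kappa u1 u2) (cobounds_symt (IHu1 (Node v1 v2)) (sc u2))
      (cobounds_lin (kappa u1 u2) (cobounds_symt (sc u1) (IHu2 (Node v1 v2)))
      (cobounds_lin (kappa v1 v2) (cobounds_symt IHv1 (sc v2))
      (cobounds_lin (kappa v1 v2) (cobounds_symt (sc v1) IHv2)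
      (cobounds_lin (kappa u1 u2 * kappa v1 v2)
         (cobounds_symt (IHu1 v1) (IHu2 v2))
      (* These mixed products arise only from multiplying two symmetrized terms. *)
      (cobounds_lin ((1 - e) * kappa u1 u2 * kappa v1 v2)
         (cobounds_symt (IHu1 v2) (IHu2 v1))
      (cobounds_symt (sc (Node u1 u2)) (sc (Node v1 v2)))))))))) => x y.
by rewrite /c !magnus_node_mul /symt /e; case: comm; ring.
Qed.

Lemma spanM f g : coef_span f -> coef_span g -> coef_span (fun t => f t * g t).
Proof.
move=> fP; elim: fP g => [u||a f1 f2 _ IH1 _ IH2|f1 f2 _ IH e] g gP; last first.
- by apply: span_ext (IH _ gP) _ => t; rewrite e.
- apply: span_ext (span_lin a (IH1 _ gP) (IH2 _ gP)) _ => t.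
  by rewrite mulrDl mulrA.
- by apply: span_ext span0 _ => t; rewrite mul0r.
elim: gP => [v||a g1 g2 _ IH1 _ IH2|g1 g2 _ IH e]; last first.
- by apply: span_ext IH _ => t; rewrite e.
- by apply: span_ext (span_lin a IH1 IH2) _ => t; ring.
- by apply: span_ext span0 _ => t; rewrite mulr0.
exact: span_coefM.
Qed.

(** Lagrange interpolation: a coefficient nonzero at [s], times a factor c_u - c_u(t) for each [t]
    to be killed. *)
Lemma span_separate s (r : seq (lterm n)) : ~ meq s LOne ->
  exists f, [/\ coef_span f, f s != 0 &
    forall t, t \in r -> ~ meq t s -> f t = 0].
Proof.
move=> s1; elim: r => [|t r [f [fP fs fr]]].
  have [[u|] /eqP hu] := not_all_ex_not _ _ s1; last by rewrite !magnus_None in hu.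
  by exists (fun t => M t (Some u)); split=> //; apply: span_coef.
case: (classic (meq t s)) => [h|h].
  by exists f; split=> // x; rewrite inE => /orP[/eqP-> //|]; apply: fr.
have [[u|] /eqP hu] := not_all_ex_not _ _ h; last by rewrite !magnus_None eqxx in hu.
(* Nonzero constants are not in the span, so the factor is multiplied out. *)
exists (fun x => - M t (Some u) * f x + f x * M x (Some u)); split.
- by apply: span_lin => //; apply: spanM => //; apply: span_coef.
- by rewrite mulNr mulrC addrC -mulrBr mulf_neq0 // subr_eq0 eq_sym.
- move=> x; rewrite inE => /orP[/eqP->|xr] hx; first by ring.
  by rewrite (fr _ xr hx); ring.
Qed.

(** * Finite sets of terms with injective Magnus map *)

Definition operand_closed (S : seq (lterm n)) := forall t, t \in S ->
  match t with
  | LMul x y | LLdiv x y | LRdiv x y => (x \in S) && (y \in S)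
  | _ => true
  end.

Definition faithful_on (S : seq (lterm n)) :=
  forall s t, s \in S -> t \in S -> meq s t -> loop_eq comm s t.

Lemma faithful_mul S a b c : operand_closed S -> faithful_on S -> LOne \in S ->
  a \in S -> b \in S -> c \in S -> meq (LMul a b) c -> loop_eq comm (LMul a b) c.
Proof.
move=> clS inj S1 aS bS cS abc.
have meq1l x : meq (LMul LOne x) x.
  by move=> [[i|u v]|] /=; rewrite /cross /= ?magnus_None ?mul0r ?mulr0 ?if_same; ring.
have meq1r x : meq (LMul x LOne) x.
  by move=> [[i|u v]|] /=; rewrite /cross /= ?magnus_None ?mul0r ?mulr0 ?if_same; ring.
have refl x : meq x x by [].
(* Functions in the span vanish at the identity, so interpolation needs [a] and [b] distinct from
   it. *)
case: (classic (meq a LOne)) => [a1|a1].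
  have bc : meq b c.
    by apply: meq_trans abc; apply: meq_trans (meq_mul (meq_sym a1) (refl b)); apply: meq_sym.
  apply: le_trans (inj _ _ bS cS bc).
  by apply: le_trans (le_mul1l _ b); apply: le_mul (inj _ _ aS S1 a1) (le_refl _ _).
case: (classic (meq b LOne)) => [b1|b1].
  have ac : meq a c.
    by apply: meq_trans abc; apply: meq_trans (meq_mul (refl a) (meq_sym b1)); apply: meq_sym.
  apply: le_trans (inj _ _ aS cS ac).
  by apply: le_trans (le_mul1r _ a); apply: le_mul (le_refl _ _) (inj _ _ bS S1 b1).
(* A product in [S] taken at (a, b), up to equality of series, already proves the claim; [knownC]
   covers the reversed pair. *)
have known x y z : x \in S -> y \in S -> z \in S -> meq (LMul x y) z ->
    loop_eq comm (LMul x y) z -> meq x a -> meq y b -> loop_eq comm (LMul a b) c.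
  move=> xS yS zS mz lz xa yb.
  have zc : meq z c.
    by apply: meq_trans abc; apply: meq_trans (meq_mul xa yb); apply: meq_sym.
  apply: le_trans (inj _ _ zS cS zc); apply: le_trans lz.
  by apply: le_sym; apply: le_mul; apply: inj.
have knownC x y z : x \in S -> y \in S -> z \in S -> meq (LMul x y) z ->
    loop_eq comm (LMul x y) z -> comm -> meq y a -> meq x b ->
    loop_eq comm (LMul a b) c.
  move=> xS yS zS mz lz cc ya xb; apply: (known y x z) => //.
    by apply: meq_trans mz; apply: meq_mulC.
  by apply: le_trans lz; apply: le_comm.
apply: NNPP => nabc.
have [g [gP ga gS]] := span_separate S a1.
have [h [hP hb hS]] := span_separate S b1.
(* On [S], [symt g h] is supported at (a, b), and also at (b, a) in the commutative case. *)
have [f [fP fG fM]] := cobounds_symt gP hP.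
have symt0 x y z : x \in S -> y \in S -> z \in S -> meq (LMul x y) z ->
    loop_eq comm (LMul x y) z -> symt g h x y = 0.
  move=> xS yS zS mz lz; rewrite /symt.
  have -> : g x * h y = 0.
    case: (classic (meq x a)) => [xa|/gS-> //]; last by rewrite mul0r.
    case: (classic (meq y b)) => [yb|/hS-> //]; last by rewrite mulr0.
    by case: nabc; apply: known mz lz xa yb.
  rewrite add0r; case: ifP => // cc.
  case: (classic (meq y a)) => [ya|/gS-> //]; last by rewrite mulr0.
  case: (classic (meq x b)) => [xb|/hS-> //]; last by rewrite mul0r.
  by case: nabc; apply: knownC mz lz cc ya xb.
have f0 : forall t, t \in S -> f t = 0.
  elim=> [i||x IHx y IHy|x IHx z IHz|z IHz y IHy] tS //.
  - exact: span_one.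
  - have /andP[xS yS] := clS _ tS.
    by rewrite fM IHx // IHy // (symt0 _ _ _ xS yS tS) ?addr0 //; apply: le_refl.
  - have /andP[xS zS] := clS _ tS.
    have mz := meq_mul_ldiv x z; have := span_meq fP mz.
    by rewrite fM IHx // IHz // (symt0 _ _ _ xS tS zS mz (le_mul_ldiv _ _ _)) add0r addr0.
  - have /andP[zS yS] := clS _ tS.
    have mz := meq_mul_rdiv y z; have := span_meq fP mz.
    by rewrite fM IHy // IHz // (symt0 _ _ _ tS yS zS mz (le_mul_rdiv _ _ _)) !addr0.
have := span_meq fP abc; rewrite fM !f0 // !add0r /symt.
have gh : g a * h b != 0 by rewrite mulf_neq0.
case: ifP => cc; last by apply/eqP; rewrite addr0.
(* If [a] and [b] have equal series, the summands add up to 2 g(a) h(b); otherwise h(a) = 0. *)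
case: (classic (meq a b)) => [ab|nab]; last first.
  by rewrite (hS _ aS nab) mul0r addr0; apply/eqP.
rewrite -(span_meq gP ab) (span_meq hP ab) [h b * _]mulrC -mulr2n => /eqP.
by rewrite -mulr_natr mulf_eq0 (negbTE gh).
Qed.

(** * Enlarging such sets one operation at a time *)

Lemma faithful_cons S s : faithful_on S ->
  (forall r, r \in S -> meq s r -> loop_eq comm s r) -> faithful_on (s :: S).
Proof.
move=> inj sP x y; rewrite !inE => /orP[/eqP->|xS] /orP[/eqP->|yS] h.
- exact: le_refl.
- exact: sP.
- by apply: le_sym; apply: sP => //; apply: meq_sym.
- exact: inj.
Qed.

Lemma operand_closed_cons S s : operand_closed S ->
  match s with
  | LMul x y | LLdiv x y | LRdiv x y => (x \in S) && (y \in S)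
  | _ => true
  end -> operand_closed (s :: S).
Proof.
move=> clS sP t; rewrite inE => /orP[/eqP->|/clS].
  by case: s sP => //= x y /andP[xS yS]; rewrite !inE xS yS !orbT.
by case: t => //= x y /andP[xS yS]; rewrite !inE xS yS !orbT.
Qed.

Definition admissible S := [/\ operand_closed S, faithful_on S,
  LOne \in S & forall i, LGen i \in S].

(** Degree-one coefficients distinguish the generators from each other and from 1. *)
Lemma admissible_gens : admissible (LOne :: [seq LGen i | i <- enum 'I_n]).
Proof.
have mem t : t \in LOne :: [seq LGen i | i <- enum 'I_n] -> t = LOne \/ exists i, t = LGen i.
  by rewrite inE => /orP[/eqP->|/mapP[i _ ->]]; [left|right; exists i].
split=> //.
- by move=> t /mem[->|[i ->]].
- move=> s t /mem[->|[i ->]] /mem[->|[j ->]] h; try exact: le_refl.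
  + by have := h (Some (Leaf j)); rewrite /= eqxx.
  + by have := h (Some (Leaf i)); rewrite /= eqxx.
  + by have := h (Some (Leaf i)); rewrite /= eqxx; case: eqP => // -> _; apply: le_refl.
- exact: mem_head.
- by move=> i; rewrite inE map_f ?orbT // mem_enum.
Qed.

(** Operands are added before the term itself; divisions reduce to products. *)
Lemma admissible_extend t S : admissible S ->
  exists2 S', admissible S' & {subset S <= S'} /\ t \in S'.
Proof.
have add S0 s : admissible S0 ->
    match s with
    | LMul x y | LLdiv x y | LRdiv x y => (x \in S0) && (y \in S0)
    | _ => true
    end ->
    (forall r, r \in S0 -> meq s r -> loop_eq comm s r) -> admissible (s :: S0).
  move=> [cl inj S1 SG] sP sr; split.
  - exact: operand_closed_cons.
  - exact: faithful_cons.
  - by rewrite inE S1 orbT.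
  - by move=> i; rewrite inE SG orbT.
have refl x : meq x x by [].
elim: t S => [i||x IHx y IHy|x IHx z IHz|z IHz y IHy] S adm.
- by exists S => //; split=> //; case: adm.
- by exists S => //; split=> //; case: adm.
- have [S1 adm1 [s1 xS1]] := IHx _ adm; have [S2 adm2 [s2 yS]] := IHy _ adm1.
  have xS := s2 _ xS1; have [cl inj S21 _] := adm2.
  exists (LMul x y :: S2); last first.
    by split=> [t /s1 /s2|]; rewrite inE ?eqxx // => ->; rewrite orbT.
  apply: add => //; first by rewrite xS yS.
  by move=> r rS; apply: (faithful_mul cl inj).
- have [S1 adm1 [s1 xS1]] := IHx _ adm; have [S2 adm2 [s2 zS]] := IHz _ adm1.
  have xS := s2 _ xS1; have [cl inj S21 _] := adm2.
  exists (LLdiv x z :: S2); last first.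
    by split=> [t /s1 /s2|]; rewrite inE ?eqxx // => ->; rewrite orbT.
  apply: add => //; first by rewrite xS zS.
  move=> r rS h; have xr : meq (LMul x r) z.
    by apply: meq_trans (meq_mul_ldiv x z); apply: meq_mul => //; apply: meq_sym.
  (* In the loop x r = z by [faithful_mul], whence x \ z = x \ (x r) = r. *)
  apply: le_trans (le_ldiv_mul _ x r); apply: le_ldiv; first exact: le_refl.
  by apply: le_sym; apply: (faithful_mul cl inj).
- have [S1 adm1 [s1 zS1]] := IHz _ adm; have [S2 adm2 [s2 yS]] := IHy _ adm1.
  have zS := s2 _ zS1; have [cl inj S21 _] := adm2.
  exists (LRdiv z y :: S2); last first.
    by split=> [t /s1 /s2|]; rewrite inE ?eqxx // => ->; rewrite orbT.
  apply: add => //; first by rewrite yS zS.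
  move=> r rS h; have ry : meq (LMul r y) z.
    by apply: meq_trans (meq_mul_rdiv y z); apply: meq_mul => //; apply: meq_sym.
  apply: le_trans (le_rdiv_mul _ y r); apply: le_rdiv; last exact: le_refl.
  by apply: le_sym; apply: (faithful_mul cl inj).
Qed.

Lemma magnus_inj s t : (forall m, M s m = M t m) -> loop_eq comm s t.
Proof.
have [S1 adm1 [_ sS]] := admissible_extend s admissible_gens.
have [S2 [_ inj _ _] [sub tS]] := admissible_extend t adm1.
exact: inj (sub _ sS) tS.
Qed.

End Magnus.

Theorem theorem5p1 (n : nat) :
  (forall s t : lterm n,
     (forall m, magnus false s m = magnus false t m) -> loop_eq false s t) /\
  (forall s t : lterm n,
     (forall m, magnus true s m = magnus true t m) -> loop_eq true s t).
Proof. by split=> s t; apply: magnus_inj. Qed.
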